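(* Let $k\ge2$ and $n,p\ge1$, let $\mathcal{A}\in\mathbb{C}^{n\times\dots\times n\times p}$ be an order $2k+1$ $t$-conjugate partially symmetric hypermatrix, let $h_{\mathcal{A}}$ be its corresponding $t$-Hermitian form, and denote $M_\ell:=M_{cb}(\widehat{\mathcal{A}}_{(\ell)})$ and $S_\ell:=M_{sym}(\widehat{\mathcal{A}}_{(\ell)})$ for each $\ell\in[p]$. Then: (1) if for each $\ell\in[p]$, either $M_\ell$ or $S_\ell$ is Hermitian positive semidefinite, then $h_{\mathcal{A}}$ is $t$-Hermitian positive semidefinite; (2) if for each $\ell\in[p]$, $S_\ell$ is Hermitian positive definite, then $h_{\mathcal{A}}$ is $t$-Hermitian positive definite.
   Context: Notation: $[m]=\{1,\dots,m\}$. For a tube $a\in\mathbb{C}^p$, $\widehat a[\ell]=\sum_{m=1}^p e^{-2\pi i(\ell-1)(m-1)/p}a[m]$. For a hypermatrix whose last mode has length $p$, the hat denotes applying this transform along that mode, and the subscript $(\ell)$ denotes fixing the last index to $\ell$. Conjugate partial symmetry: an order $2k$ hypermatrix $\mathcal{B}=[b_{i_1\dots i_kj_1\dots j_k}]\in\mathbb{C}^{n\times\dots\times n}$ is conjugate partially symmetric if $\overline{b_{j_{\sigma(1)}\dots j_{\sigma(k)}i_{\tau(1)}\dots i_{\tau(k)}}}=b_{i_1\dots i_kj_1\dots j_k}$ for all indices and all $\sigma,\tau\in S_k$. An order $2k+1$ hypermatrix $\mathcal{A}\in\mathbb{C}^{n\times\dots\times n\times p}$ is $t$-conjugate partially symmetric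 if every $\widehat{\mathcal{A}}_{(\ell)}$, $\ell\in[p]$, is conjugate partially symmetric. Matricizations of a conjugate partially symmetric $\mathcal{B}$ of order $2k$: the cubically balanced matricization $M_{cb}(\mathcal{B})$ is the $n^k\times n^k$ matrix with $(M_{cb}(\mathcal{B}))_{\psi(\mathbf i),\psi(\mathbf j)}=b_{\mathbf i\mathbf j}$ for $\mathbf i,\mathbf j\in[n]^k$, where $\psi(\mathbf i)=1+\sum_{r=1}^k(i_r-1)n^{k-r}$. Let $\mathcal{I}_k=\{(i_1,\dots,i_k)\in[n]^k:i_1\le\dots\le i_k\}$, let $\varphi:\mathcal{I}_k\to[\binom{n+k-1}{k}]$ be the enumeration $\varphi(\mathbf i)=1+\sum_{q=1}^k\binom{i_q+q-2}{q}$, and let $\eta(\mathbf i)$ be the number of distinct permutations of $\mathbf i$. The (normalized) symmetric matricization $M_{sym}(\mathcal{B})$ is the $\binom{n+k-1}{k}\times\binom{n+k-1}{k}$ matrix with $(M_{sym}(\mathcal{B}))_{\varphi(\mathbf i),\varphi(\mathbf j)}=\sqrt{\eta(\mathbf i)\eta(\mathbf j)}\,b_{\mathbf i\mathbf j}$ for $\mathbf i,\mathbf j\in\mathcal{I}_k$. A matrix is Hermitian positive (semi)definite in the usual sense. $t$-Hermitian forms: $\mathbb{T}_p\cong\mathbb{C}^p$ is the algebra of tubes with product $(a\circledast b)[\ell]=\sum_{m=1}^p a[m]\,b[((\ell-m)\bmod p)+1]$, and $\mathbb{T}_p^n\cong\mathbb{C}^{n\times1\times p}$. $J(a)[\ell+1]=\overline{a[((-\ell)\bmod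 p)+1]}$, $\ell=0,\dots,p-1$. For $\mathcal{Z}\in\mathbb{T}_p^n$ with tubes $\mathcal{Z}[i,:]$, $h_{\mathcal{A}}(\mathcal{Z})=\sum \mathcal{A}[i_1,\dots,i_k,j_1,\dots,j_k,:]\circledast J(\mathcal{Z}[i_1,:])\circledast\cdots\circledast J(\mathcal{Z}[i_k,:])\circledast\mathcal{Z}[j_1,:]\circledast\cdots\circledast\mathcal{Z}[j_k,:]\in\mathbb{T}_p$, summing over all indices in $[n]$. With $\mathbb{T}_p^+=\{a\in\mathbb{T}_p:\widehat a[\ell]\ge0\ \forall\ell\in[p]\}$, $h_{\mathcal{A}}$ is $t$-Hermitian positive definite (semidefinite) if $h_{\mathcal{A}}(\mathcal{Z})\in\mathbb{T}_p^+\setminus\{0\}$ ($\in\mathbb{T}_p^+$) for all nonzero $\mathcal{Z}\in\mathbb{T}_p^n$. *)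

(* Defs.v *)
From mathcomp Require Import all_boot all_order all_algebra.
From mathcomp Require Import perm complex reals trigo.

Set Implicit Arguments.
Unset Strict Implicit.
Unset Printing Implicit Defensive.

Import Order.TTheory GRing.Theory Num.Theory.

Local Open Scope complex_scope.
Local Open Scope sesquilinear_scope.
Local Open Scope ring_scope.

(* All indices are 0-based: the index set [m] is 'I_m. The complex numbers are
   R[i] for a realType R; on R[i], 0 <= z means that z is real and nonnegative.
   A tube of length p >= 1 is a row vector whose length has the form p.+1, so
   that subtraction of positions in 'I_p.+1 is subtraction modulo the length. *)

Section Tubes.
Variables (R : realType) (p : nat).
Implicit Types a b : 'rV[R[i]]_p.+1.

Definition expi (x : R) : R[i] := cos x +i* sin x.

Definition dft a : 'rV[R[i]]_p.+1 :=
  \row_l \sum_(m < p.+1) expi (- (2 * pi * l%:R * m%:R / p.+1%:R)) * a 0 m.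

Definition tube_mul a b : 'rV[R[i]]_p.+1 :=
  \row_l \sum_(m < p.+1) a 0 m * b 0 (l - m).

Definition tube_conj a : 'rV[R[i]]_p.+1 := \row_l (a 0 (- l))^*.

Definition tube_nonneg a : Prop := forall l, 0 <= dft a 0 l.

End Tubes.

(* An order m hypermatrix of size n x ... x n. An order m + 1 hypermatrix of
   size n x ... x n x p is encoded as one of order m whose entries are tubes. *)
Definition hypermatrix (T : Type) (m n : nat) := m.-tuple 'I_n -> T.

Definition dft_slice (R : realType) (m n p : nat)
    (A : hypermatrix 'rV[R[i]]_p.+1 m n) (l : 'I_p.+1) : hypermatrix R[i] m n :=
  fun i => dft (A i) 0 l.

Definition tuple_perm (T : Type) (k : nat) (s : 'S_k) (i : k.-tuple T) :
    k.-tuple T := [tuple tnth i (s r) | r < k].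

Definition conj_partially_symmetric (R : realType) (k n : nat)
    (B : hypermatrix R[i] (k + k) n) : Prop :=
  forall (i j : k.-tuple 'I_n) (s t : 'S_k),
    (B [tuple of tuple_perm s j ++ tuple_perm t i])^* = B [tuple of i ++ j].

Definition t_conj_partially_symmetric (R : realType) (k n p : nat)
    (A : hypermatrix 'rV[R[i]]_p.+1 (k + k) n) : Prop :=
  forall l, conj_partially_symmetric (dft_slice A l).

Section Matricizations.
Variables (k n : nat).
Implicit Types i j : k.-tuple 'I_n.

Definition psi i : nat := (\sum_(r < k) tnth i r * n ^ (k - r.+1))%N.

Definition weakly_increasing i : bool := sorted leq [seq val x | x <- i].

(* The binomial 'C(i_q + q - 2, q) with i_q and q counted from 1 becomes
   'C(i_q + q, q + 1) with both counted from 0. *)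
Definition phi i : nat := (\sum_(q < k) 'C(tnth i q + q, q.+1))%N.

Definition eta i : nat := #|[set j : k.-tuple 'I_n | perm_eq i j]|.

Variable R : realType.
Implicit Types B : hypermatrix R[i] (k + k) n.

(* psi is a bijection onto [0, n ^ k) and phi, restricted to weakly increasing
   tuples, is a bijection onto [0, 'C(n + k - 1, k)): each double sum below has
   exactly one term (see M_cbE and M_symE). *)
Definition M_cb B : 'M[R[i]]_(n ^ k) :=
  \matrix_(u, v) \sum_(i | psi i == u) \sum_(j | psi j == v)
    B [tuple of i ++ j].

Definition M_sym B : 'M[R[i]]_('C(n + k - 1, k)) :=
  \matrix_(u, v) \sum_(i | weakly_increasing i && (phi i == u))
                 \sum_(j | weakly_increasing j && (phi j == v))
    sqrtC (eta i * eta j)%:R * B [tuple of i ++ j].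

End Matricizations.

Definition hermitian_psd (R : realType) (m : nat) (M : 'M[R[i]]_m) : Prop :=
  M \is hermsymmx /\ forall x : 'cV[R[i]]_m, 0 <= (x ^t* *m M *m x) 0 0.

Definition hermitian_pd (R : realType) (m : nat) (M : 'M[R[i]]_m) : Prop :=
  M \is hermsymmx /\
  forall x : 'cV[R[i]]_m, x != 0 -> 0 < (x ^t* *m M *m x) 0 0.

(* The element Z of T_p^n is the matrix whose rows are the tubes Z[i, :]. *)
Definition t_form (R : realType) (k n p : nat)
    (A : hypermatrix 'rV[R[i]]_p.+1 (k + k) n) (Z : 'M[R[i]]_(n, p.+1)) :
    'rV[R[i]]_p.+1 :=
  \sum_(i : k.-tuple 'I_n) \sum_(j : k.-tuple 'I_n)
    foldl (@tube_mul R p) (A [tuple of i ++ j])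
      ([seq tube_conj (row x Z) | x <- i] ++ [seq row x Z | x <- j]).

Definition t_hermitian_psd (R : realType) (n p : nat)
    (h : 'M[R[i]]_(n, p.+1) -> 'rV[R[i]]_p.+1) : Prop :=
  forall Z, Z != 0 -> tube_nonneg (h Z).

Definition t_hermitian_pd (R : realType) (n p : nat)
    (h : 'M[R[i]]_(n, p.+1) -> 'rV[R[i]]_p.+1) : Prop :=
  forall Z, Z != 0 -> tube_nonneg (h Z) /\ h Z != 0.

Section MatricizationFacts.
Local Open Scope nat_scope.

Lemma radix_lt n k (f : nat -> nat) :
  (forall r, r < k -> f r < n) -> \sum_(r < k) f r * n ^ (k - r.+1) < n ^ k.
Proof.
elim: k => [|k IHk] fn; first by rewrite big_ord0.
rewrite big_ord_recr /= subnn muln1.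
under eq_bigr => r _ do rewrite subSn // expnSr mulnA.
rewrite -big_distrl /= expnSr.
have fk := fn k (ltnSn k).
apply: (@leq_trans (((\sum_(r < k) f r * n ^ (k - r.+1)).+1) * n)).
  by rewrite mulSn addnC ltn_add2r.
by rewrite leq_mul2r IHk ?orbT // => r rk; apply/fn/ltnW.
Qed.

Lemma radix_inj n k (f g : nat -> nat) :
  (forall r, r < k -> f r < n) -> (forall r, r < k -> g r < n) ->
  \sum_(r < k) f r * n ^ (k - r.+1) = \sum_(r < k) g r * n ^ (k - r.+1) ->
  forall r, r < k -> f r = g r.
Proof.
elim: k => [|k IHk] fn gn //.
rewrite !big_ord_recr /= subnn !muln1.
under eq_bigr => r _ do rewrite subSn // expnSr mulnA.
under [in X in _ = X -> _]eq_bigr => r _ do rewrite subSn // expnSr mulnA.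
rewrite -!big_distrl /= => E r.
have fk := fn k (ltnSn k); have gk := gn k (ltnSn k).
have n0 : 0 < n by case: (n) fk.
have Ek : f k = g k.
  by have := congr1 (modn^~ n) E; rewrite /= !modnMDl !modn_small.
rewrite ltnS leq_eqVlt => /orP[/eqP->//|].
apply: IHk => [s sk|s sk|]; [exact/fn/ltnW|exact/gn/ltnW|].
move: E; rewrite Ek => /addIn /eqP.
by rewrite eqn_pmul2r // => /eqP.
Qed.

Lemma binom_rank_lt k m (f : nat -> nat) :
  (forall q r, q <= r -> r < k -> f q <= f r) -> (forall r, r < k -> f r <= m) ->
  \sum_(q < k) 'C(f q + q, q.+1) < 'C(m + k, k).
Proof.
elim: k m => [|k IHk] m fh fm; first by rewrite big_ord0 bin0.
rewrite big_ord_recr /=.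
have fk := fm k (ltnSn k).
apply: (@leq_trans 'C(f k + k.+1, k.+1)); last first.
  by apply: leq_bin2l; rewrite leq_add2r.
rewrite addnS binS addnC ltn_add2l; apply: IHk => [q r qr rk|r rk].
  by apply: fh => //; apply: ltnW.
by apply: fh => //; apply: ltnW.
Qed.

Lemma binom_rank_inj k (f g : nat -> nat) :
  (forall q r, q <= r -> r < k -> f q <= f r) ->
  (forall q r, q <= r -> r < k -> g q <= g r) ->
  \sum_(q < k) 'C(f q + q, q.+1) = \sum_(q < k) 'C(g q + q, q.+1) ->
  forall r, r < k -> f r = g r.
Proof.
elim: k => [|k IHk] fh gh // E r.
have lt_rank f1 g1 : (forall q r, q <= r -> r < k.+1 -> f1 q <= f1 r) ->
    f1 k < g1 k ->
    \sum_(q < k.+1) 'C(f1 q + q, q.+1) < \sum_(q < k.+1) 'C(g1 q + q, q.+1).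
  move=> f1h fg; rewrite [X in _ < X]big_ord_recr /=.
  apply: (@leq_trans 'C(f1 k + k.+1, k.+1)); last first.
    apply: leq_trans (leq_addl _ _); apply: leq_bin2l.
    by rewrite addnS -addSn leq_add2r.
  by apply: binom_rank_lt => // s sk; apply: f1h.
have Ek : f k = g k.
  by case: (ltngtP (f k) (g k)) => // /lt_rank; [move=> /(_ fh)|move=> /(_ gh)];
     rewrite E ltnn.
rewrite ltnS leq_eqVlt => /orP[/eqP->//|].
apply: IHk => [s t st tk|s t st tk|].
- by apply: fh => //; apply: ltnW.
- by apply: gh => //; apply: ltnW.
by move: E; rewrite !big_ord_recr /= Ek => /addIn.
Qed.

Lemma card_weakly_increasing k n : 0 < n ->
  #|[set i : k.-tuple 'I_n | weakly_increasing i]| = 'C(n + k - 1, k).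
Proof.
by case: n => // n _; rewrite card_sorted_tuples addSn subn1 addnC.
Qed.

Variables (k n : nat).
Implicit Types i j : k.-tuple 'I_n.

Let digit i (r : nat) : nat := nth 0 [seq val x | x <- i] r.

Let digitE i (r : 'I_k) : tnth i r = digit i r :> nat.
Proof. by rewrite /digit -(tnth_map val) (tnth_nth 0). Qed.

Let digit_lt i r : r < k -> digit i r < n.
Proof. by move=> rk; rewrite -(digitE i (Ordinal rk)). Qed.

Let digit_inj i j : (forall r, r < k -> digit i r = digit j r) -> i = j.
Proof.
by move=> ij; apply/eq_from_tnth => r; apply/val_inj; rewrite /= !digitE ij.
Qed.

Let psiE i : psi i = \sum_(r < k) digit i r * n ^ (k - r.+1).
Proof. by apply: eq_bigr => r _; rewrite digitE. Qed.

Let phiE i : phi i = \sum_(q < k) 'C(digit i q + q, q.+1).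
Proof. by apply: eq_bigr => r _; rewrite digitE. Qed.

Let digit_mono i : weakly_increasing i ->
  forall q r, q <= r -> r < k -> digit i q <= digit i r.
Proof.
move=> si q r qr rk; apply: (sorted_leq_nth leq_trans leqnn) => //;
by rewrite inE size_map size_tuple // (leq_ltn_trans qr).
Qed.

Lemma psi_lt i : psi i < n ^ k.
Proof. by rewrite psiE; apply: radix_lt => r; apply: digit_lt. Qed.

Lemma psi_inj : injective (@psi k n).
Proof.
move=> i j; rewrite !psiE => E; apply: digit_inj.
by apply: radix_inj E => r; apply: digit_lt.
Qed.

Lemma phi_lt i : 0 < n -> weakly_increasing i -> phi i < 'C(n + k - 1, k).
Proof.
move=> n0 si; have -> : n + k - 1 = n.-1 + k.
  by case: (n) n0 => // m _; rewrite subn1.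
rewrite phiE; apply: binom_rank_lt (digit_mono si) _ => r /(digit_lt i).
by case: (n) n0.
Qed.

Lemma phi_inj : {in @weakly_increasing k n &, injective (@phi k n)}.
Proof.
move=> i j si sj; rewrite !phiE => E; apply: digit_inj.
by apply: binom_rank_inj E; apply: digit_mono.
Qed.

Lemma psi_surj (u : 'I_(n ^ k)) : exists i : k.-tuple 'I_n, psi i = u.
Proof.
pose F i := Ordinal (psi_lt i).
have Finj : injective F by move=> i j /(congr1 val) /psi_inj.
have /(inj_card_onto Finj) : #|'I_(n ^ k)| <= #|{: k.-tuple 'I_n}|.
  by rewrite card_tuple !card_ord.
by move=> /(_ u) /codomP[i ->]; exists i.
Qed.

Lemma phi_surj (u : 'I_('C(n + k - 1, k))) : 0 < n ->
  exists2 i : k.-tuple 'I_n, weakly_increasing i & phi i = u.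
Proof.
move=> n0; pose S := [set i | @weakly_increasing k n i].
pose F i : 'I_('C(n + k - 1, k)) := insubd u (phi i).
have FE i : i \in S -> F i = phi i :> nat.
  by rewrite inE => si; rewrite val_insubd phi_lt.
have Finj : {in S &, injective F}.
  move=> i j iS jS /(congr1 val) /=; rewrite !FE // => E.
  by move: iS jS; rewrite !inE => si sj; exact: (@phi_inj _ _ si sj E).
have : F @: S = setT.
  apply/eqP; rewrite eqEcard subsetT cardsT card_ord card_in_imset //.
  by rewrite card_weakly_increasing ?leqnn.
move=> /setP/(_ u); rewrite inE => /imsetP[i iS ->].
by exists i; [move: iS; rewrite inE | rewrite FE].
Qed.

Variable R : realType.
Implicit Types B : hypermatrix R[i] (k + k) n.

Lemma M_cbE B i j :
  M_cb B (Ordinal (psi_lt i)) (Ordinal (psi_lt j)) = B [tuple of i ++ j].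
Proof.
rewrite mxE (big_pred1 i) ?(big_pred1 j) // => x /=;
by rewrite (inj_eq psi_inj).
Qed.

Lemma M_symE B i j (n0 : 0 < n)
    (si : weakly_increasing i) (sj : weakly_increasing j) :
  M_sym B (Ordinal (phi_lt n0 si)) (Ordinal (phi_lt n0 sj)) =
  (sqrtC (eta i * eta j)%:R * B [tuple of i ++ j])%R.
Proof.
have phi1 (a : k.-tuple 'I_n) (sa : weakly_increasing a) x :
    weakly_increasing x && (phi x == phi a) = (x == a).
  apply/andP/eqP => [[sx /eqP E]|->]; last by rewrite eqxx.
  exact: (@phi_inj _ _ sx sa E).
by rewrite mxE (big_pred1 i) ?(big_pred1 j) // => x /=; rewrite phi1.
Qed.

End MatricizationFacts.

(* Main.v *)
(* The DFT turns the tube product into the entrywise product and J into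
   conjugation, so the l-th Fourier coefficient of h_A(Z) is the Hermitian form
   of the slice l at the vector z of l-th Fourier coefficients of the rows of Z.
   That form is a quadratic form of M_cb at the vector of the monomials z_i and,
   grouping the multi-indices by their sorted rearrangement, of M_sym at the
   vector of the sqrt(eta(i)) z_i with i sorted.  If Z <> 0, injectivity of the
   DFT gives a slice with some z_x <> 0; there the second vector is nonzero,
   because of its coordinate at (x, ..., x). *)
Require Import Defs.
From mathcomp Require Import all_boot all_order all_algebra.
From mathcomp Require Import perm complex reals trigo.
From mathcomp Require Import ring lra.
Local Open Scope ring_scope.

Set Implicit Arguments.
Unset Strict Implicit.
Import Order.TTheory GRing.Theory Num.Theory.
Local Open Scope sesquilinear_scope.

(** * The discrete Fourier transform through a primitive root of unity *)

Section RootOfUnity.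
Variable R : realType.

Lemma expiD (x y : R) : expi (x + y) = expi x * expi y.
Proof. by apply/eqP; rewrite /expi cosD sinD eq_complex /= [sin x * _ + _]addrC !eqxx. Qed.

Lemma expi0 : expi (0 : R) = 1.
Proof. by rewrite /expi cos0 sin0. Qed.

Lemma expiMn (x : R) m : expi (x * m%:R) = expi x ^+ m.
Proof.
elim: m => [|m IHm]; first by rewrite mulr0 expi0.
by rewrite -natr1 mulrDr mulr1 expiD IHm exprSr.
Qed.

Lemma expi_conj (x : R) : (expi x)^* = expi (- x).
Proof. by rewrite /expi cosN sinN. Qed.

Variable p : nat.

(** The minus sign matches the kernel of [dft], so that only nonnegative powers of [omega] occur in
    it. *)
Definition omega : R[i] := expi (- (2 * pi / p.+1%:R)).

Lemma omegaX m : omega ^+ m = expi (- (2 * pi * m%:R / p.+1%:R)).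
Proof. by rewrite -expiMn; congr expi; ring. Qed.

Lemma omega_conj : omega^* = omega^-1.
Proof.
by apply/esym/mulr1_eq; rewrite expi_conj -expiD subrr expi0.
Qed.

(** Half-angle formula: cos x = 1 - 2 sin(x/2)^2, and x/2 lies strictly between 0 and pi. *)
Lemma cos_lt1 (x : R) : 0 < x < pi *+ 2 -> cos x < 1.
Proof.
move=> /andP[x0 x2]; have s0 : 0 < sin (x / 2).
  by apply: sin_gt0_pi; rewrite mulr2n in x2; lra.
have -> : x = (x / 2) *+ 2 by rewrite mulr2n; lra.
have := cos2Dsin2 (x / 2); rewrite cos_mulr2n mulr2n => E.
have : 0 < sin (x / 2) ^+ 2 by rewrite exprn_gt0.
lra.
Qed.

Lemma omega_prim : p.+1.-primitive_root omega.
Proof.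
apply/andP; split=> //; apply/forallP => j; rewrite unity_rootE omegaX.
have p0 : (p.+1%:R : R) != 0 by rewrite pnatr_eq0.
have [->|jp] := eqVneq j.+1 p.+1.
  by rewrite mulfK // /expi cosN sinN mulr_natl cos2pi sin2pi oppr0 !eqxx.
(* For a smaller exponent, comparing real parts suffices: the angle is, up to sign, strictly between
   0 and 2 pi. *)
rewrite eqbF_neg; apply/eqP => /(congr1 (@complex.Re R)) /= E.
have : cos (2 * pi * j.+1%:R / p.+1%:R : R) < 1; last by rewrite -cosN E ltxx.
have lt_jp : (j.+1 < p.+1)%N by rewrite ltn_neqAle jp ltn_ord.
have pi0 := pi_gt0 R.
apply: cos_lt1; rewrite divr_gt0 ?mulr_gt0 ?ltr0n //=.
rewrite ltr_pdivrMr ?ltr0n // -[pi *+ 2]mulr_natl.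
by rewrite ltr_pM2l ?mulr_gt0 // ltr_nat.
Qed.

Lemma dftE (a : 'rV[R[i]]_p.+1) (l : 'I_p.+1) :
  dft a 0 l = \sum_(m < p.+1) omega ^+ (l * m) * a 0 m.
Proof.
rewrite mxE; apply: eq_bigr => m _; rewrite omegaX natrM.
by congr (expi _ * _); ring.
Qed.

Lemma dftD (a b : 'rV[R[i]]_p.+1) l : dft (a + b) 0 l = dft a 0 l + dft b 0 l.
Proof.
by rewrite !dftE -big_split; apply: eq_bigr => m _; rewrite mxE mulrDr.
Qed.

Lemma dft0 l : dft (0 : 'rV[R[i]]_p.+1) 0 l = 0.
Proof. by rewrite dftE big1 // => m _; rewrite mxE mulr0. Qed.

Lemma dft_sum (I : finType) (P : pred I) (F : I -> 'rV[R[i]]_p.+1) l :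
  dft (\sum_(i | P i) F i) 0 l = \sum_(i | P i) dft (F i) 0 l.
Proof. exact: (big_morph (fun a => dft a 0 l) (fun a b => dftD a b l) (dft0 l)). Qed.

(** Addition in ['I_p.+1] wraps around modulo p + 1, which is harmless in an exponent of [omega]. *)
Lemma omega_ordD (l : nat) (m m' : 'I_p.+1) :
  omega ^+ (l * (m + m')%R) = omega ^+ (l * m) * omega ^+ (l * m').
Proof.
rewrite -exprD -mulnDr !(mulnC l) !exprM /=.
by rewrite (prim_expr_mod omega_prim).
Qed.

Lemma dft_mul (a b : 'rV[R[i]]_p.+1) l :
  dft (tube_mul a b) 0 l = dft a 0 l * dft b 0 l.
Proof.
rewrite !dftE mulr_suml.
under eq_bigr => t _ do rewrite mxE mulr_sumr.
rewrite exchange_big; apply: eq_bigr => m _ /=.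
(* The cyclic shift of the output position by m separates the two factors of the convolution. *)
rewrite (reindex_inj (addIr m)) mulr_sumr; apply: eq_bigr => t _.
by rewrite addrK omega_ordD; ring.
Qed.

Lemma dft_conj (a : 'rV[R[i]]_p.+1) l :
  dft (tube_conj a) 0 l = (dft a 0 l)^*.
Proof.
rewrite !dftE rmorph_sum (reindex_inj oppr_inj); apply: eq_bigr => m _.
rewrite mxE opprK rmorphM rmorphXn /= omega_conj; congr (_ * _).
have o0 : omega ^+ (l * m) != 0.
  by rewrite expf_neq0 // (prim_root_eq0 omega_prim).
(* Both sides are inverse to [omega ^+ (l * m)]. *)
by apply: (mulfI o0); rewrite -[X in X = _](omega_ordD l m (- m)) subrr muln0 expr0 exprVn mulfV.
Qed.

Lemma dft_foldl (a : 'rV[R[i]]_p.+1) s l :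
  dft (foldl (@tube_mul R p) a s) 0 l = dft a 0 l * \prod_(b <- s) dft b 0 l.
Proof.
elim: s a => [|b s IHs] a /=; first by rewrite big_nil mulr1.
by rewrite IHs dft_mul big_cons mulrA.
Qed.

(* The tube is the coefficient vector of a polynomial of degree at most p
   vanishing at the p + 1 distinct powers of omega. *)
Lemma dft_inj (a : 'rV[R[i]]_p.+1) : (forall l, dft a 0 l = 0) -> a = 0.
Proof.
move=> a0; pose q : {poly R[i]} := \poly_(m < p.+1) a 0 (inord m).
have q0 : q = 0.
  apply/eqP; apply: contraT => qn0.
  pose rs := [seq omega ^+ l | l <- iota 0 p.+1].
  have := max_poly_roots qn0 (rs := rs).
  rewrite size_map size_iota ltnNge size_poly; apply.
    apply/allP => _ /mapP[l + ->]; rewrite mem_iota add0n => lp.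
    rewrite rootE horner_poly -[X in _ == X](a0 (Ordinal lp)) dftE; apply/eqP.
    by apply: eq_bigr => m _; rewrite inord_val exprM mulrC.
  rewrite map_inj_in_uniq ?iota_uniq // => i j.
  rewrite !mem_iota !add0n => ip jp /eqP.
  by rewrite (eq_prim_root_expr omega_prim) !modn_small // => /eqP.
apply/rowP => m; rewrite mxE.
have := coef_poly p.+1 (fun m => a 0 (inord m)) m.
by rewrite -/q q0 coef0 ltn_ord inord_val.
Qed.

End RootOfUnity.

(** * Hermitian forms and the cubically balanced matricization *)

Section QuadraticForms.
Variables (R : realType) (k n : nat).
Implicit Types (B : hypermatrix R[i] (k + k) n) (z : 'I_n -> R[i]).
Implicit Types (i j : k.-tuple 'I_n).

Definition monomial z i : R[i] := \prod_(x <- i) z x.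

Definition hermitian_form B z : R[i] :=
  \sum_(i : k.-tuple 'I_n) \sum_(j : k.-tuple 'I_n)
    B [tuple of i ++ j] * ((monomial z i)^* * monomial z j).

(** Allows rows and columns to be indexed by tuples instead of their ranks under [psi] or [phi]. *)
Lemma quadratic_form_reindex (I : finType) m (f : I -> 'I_m)
    (M : 'M[R[i]]_m) (x : 'cV[R[i]]_m) : bijective f ->
  (x^t* *m M *m x) 0 0 =
  \sum_i \sum_j (x (f i) 0)^* * M (f i) (f j) * x (f j) 0.
Proof.
move=> f_bij; rewrite mxE exchange_big (reindex f) /=; last exact: onW_bij.
apply: eq_bigr => j _; rewrite mxE mulr_suml (reindex f) /=; last exact: onW_bij.
by apply: eq_bigr => i _; rewrite !mxE.
Qed.

Definition psi_ord i : 'I_(n ^ k) := Ordinal (psi_lt i).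

Lemma psi_ord_bij : bijective psi_ord.
Proof.
apply: inj_card_bij => [i j /(congr1 val) /psi_inj //|].
by rewrite card_tuple !card_ord.
Qed.

Lemma hermitian_form_cb B z (x : 'cV[R[i]]_(n ^ k)) :
  (forall i, x (psi_ord i) 0 = monomial z i) ->
  hermitian_form B z = (x^t* *m M_cb B *m x) 0 0.
Proof.
move=> xE; rewrite (quadratic_form_reindex _ _ psi_ord_bij).
apply: eq_bigr => i _; apply: eq_bigr => j _; rewrite !xE M_cbE; ring.
Qed.

(** * The symmetric matricization and sorted multi-indices *)

Hypothesis n_gt0 : (0 < n)%N.

Definition phi_ord (i : {i | @weakly_increasing k n i}) : 'I_('C(n + k - 1, k)) :=
  Ordinal (phi_lt n_gt0 (valP i)).

Lemma phi_ord_bij : bijective phi_ord.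
Proof.
apply: inj_card_bij => [i j /(congr1 val) /= E|].
  by apply: val_inj; apply: phi_inj E; apply: valP.
by rewrite card_ord card_sig -(card_weakly_increasing _ n_gt0) cardsE.
Qed.

Definition sort_tuple i : k.-tuple 'I_n :=
  [tuple of sort (relpre val leq) i].

Lemma weakly_increasing_sort i : weakly_increasing (sort_tuple i).
Proof.
rewrite /weakly_increasing sorted_map; apply: sort_sorted => x y.
exact: leq_total.
Qed.

(** A multiset has only one sorted arrangement; hence the fibre of [sort_tuple] over a sorted [j] is
    the set counted by [eta j]. *)
Lemma sort_tuple_eq i j :
  weakly_increasing j -> (sort_tuple i == j) = perm_eq j i.
Proof.
move=> wj; apply/eqP/idP => [<-|ji]; first by rewrite perm_sort.
apply: val_inj => /=.
apply: (@sorted_eq _ (relpre val leq)) => /=.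
- by move=> x y t; apply: leq_trans.
- by move=> x y /anti_leq E; apply: val_inj.
- by apply: sort_sorted => x y; apply: leq_total.
- by rewrite -sorted_map.
by rewrite perm_sort perm_sym.
Qed.

(** The sum is split along the fibres of [sort_tuple], on each of which [G] is constant. *)
Lemma sum_weakly_increasing (G : k.-tuple 'I_n -> R[i]) :
  (forall i j, perm_eq i j -> G i = G j) ->
  \sum_i G i =
  \sum_(i : {i | @weakly_increasing k n i}) (eta (val i))%:R * G (val i).
Proof.
move=> Gperm.
rewrite (partition_big sort_tuple (@weakly_increasing k n)) /=; last first.
  by move=> i _; apply: weakly_increasing_sort.
rewrite (reindex_omap (val : {i | @weakly_increasing k n i} -> _) insub); last first.
  by move=> j wj; rewrite insubT.
rewrite (eq_bigl xpredT) => [|j]; last by rewrite valK eqxx (valP j).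
apply: eq_bigr => -[j wj] _ /=.
rewrite (eq_bigl [in [set i : k.-tuple 'I_n | perm_eq j i]]); last first.
  by move=> i; rewrite inE sort_tuple_eq.
rewrite (eq_bigr (fun=> G j)); last by move=> i; rewrite inE => /Gperm.
by rewrite sumr_const mulr_natl.
Qed.

Lemma monomial_perm z i j : perm_eq i j -> monomial z i = monomial z j.
Proof. exact: perm_big. Qed.

Lemma conj_partially_symmetric_perm B i i' j j' :
  conj_partially_symmetric B -> perm_eq i i' -> perm_eq j j' ->
  B [tuple of i ++ j] = B [tuple of i' ++ j'].
Proof.
move=> symB ii' jj'.
have /tuple_permP[s Es] := ii'; have /tuple_permP[t Et] := jj'.
have -> : i = tuple_perm s i' by apply: val_inj.
have -> : j = tuple_perm t j' by apply: val_inj.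
have E1 T (u : k.-tuple T) : tuple_perm 1%g u = u.
  by apply: eq_from_tnth => r; rewrite tnth_mktuple perm1.
(* The symmetry exchanges the two blocks and conjugates, so it is used twice: first with [s] and
   [t], then with identities to exchange the blocks back. *)
rewrite -[LHS]conjCK symB.
by rewrite -(symB j' i' 1%g 1%g) conjCK !E1.
Qed.

Lemma hermitian_form_sym B z (x : 'cV[R[i]]_('C(n + k - 1, k))) :
  conj_partially_symmetric B ->
  (forall w, x (phi_ord w) 0 = sqrtC (eta (val w))%:R * monomial z (val w)) ->
  hermitian_form B z = (x^t* *m M_sym B *m x) 0 0.
Proof.
move=> symB xE; rewrite (quadratic_form_reindex _ _ phi_ord_bij).
rewrite /hermitian_form sum_weakly_increasing => [|i i' ii']; last first.
  apply: eq_bigr => j _; rewrite (monomial_perm z ii').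
  by rewrite (conj_partially_symmetric_perm symB ii' (perm_refl j)).
apply: eq_bigr => i _; rewrite sum_weakly_increasing => [|j j' jj']; last first.
  rewrite (monomial_perm z jj').
  by rewrite (conj_partially_symmetric_perm symB (perm_refl _) jj').
rewrite mulr_sumr; apply: eq_bigr => j _; rewrite !xE M_symE.
rewrite natrM sqrtCM ?nnegrE ?ler0n // rmorphM /=.
have -> : (sqrtC (eta (val i))%:R : R[i])^* = sqrtC (eta (val i))%:R.
  by apply: conj_Creal; rewrite ger0_real // sqrtC_ge0 ler0n.
(* Of the two square roots of each weight [eta], one belongs to the vector and the other to the
   entry of [M_sym]. *)
have sq m : m%:R = sqrtC m%:R ^+ 2 :> R[i] by rewrite sqrtCK.
rewrite [X in X * _ = _]sq [X in _ * (X * _) = _]sq.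
ring.
Qed.

(** The sum has a single term and stands for the inverse of [phi_ord]. *)
Definition sym_vector z : 'cV[R[i]]_('C(n + k - 1, k)) :=
  \col_u \sum_(w | phi_ord w == u) sqrtC (eta (val w))%:R * monomial z (val w).

Lemma sym_vectorE z w :
  sym_vector z (phi_ord w) 0 = sqrtC (eta (val w))%:R * monomial z (val w).
Proof.
by rewrite mxE (big_pred1 w) // => j; rewrite /= (inj_eq (bij_inj phi_ord_bij)).
Qed.

Lemma sym_vector_neq0 z x : z x != 0 -> sym_vector z != 0.
Proof.
move=> zx; apply/eqP => v0.
have wx : weakly_increasing [tuple of nseq k x].
  rewrite /weakly_increasing map_nseq.
  by elim: (k) => [|[|m] IHm] //=; rewrite leqnn.
(* This coordinate is sqrt(eta) times the k-th power of [z x], and [eta] is positive because a tuple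
   is a permutation of itself. *)
have /eqP := sym_vectorE z (Sub [tuple of nseq k x] wx).
rewrite v0 mxE eq_sym mulf_eq0 sqrtC_eq0 pnatr_eq0 /= => /orP[|].
  rewrite -leqn0 leqNgt => /negP[]; apply/card_gt0P.
  by exists [tuple of nseq k x]; rewrite inE.
rewrite /monomial big_nseq; apply/negP.
by elim: (k) => [|m IHm] /=; [rewrite oner_eq0 | rewrite mulf_neq0].
Qed.

(** * Positivity of the slices and of the tube-valued form *)

Lemma hermitian_form_cb_ge0 B z :
  hermitian_psd (M_cb B) -> 0 <= hermitian_form B z.
Proof.
move=> [_ psd].
rewrite (@hermitian_form_cb B z (\col_u \sum_(i | psi_ord i == u) monomial z i)) //.
move=> i; rewrite mxE (big_pred1 i) // => j.
by rewrite /= (inj_eq (bij_inj psi_ord_bij)).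
Qed.

Lemma hermitian_form_sym_ge0 B z : conj_partially_symmetric B ->
  hermitian_psd (M_sym B) -> 0 <= hermitian_form B z.
Proof.
by move=> symB [_ psd]; rewrite (hermitian_form_sym symB (sym_vectorE z)).
Qed.

Lemma hermitian_form_sym_gt0 B z x : conj_partially_symmetric B ->
  hermitian_pd (M_sym B) -> z x != 0 -> 0 < hermitian_form B z.
Proof.
move=> symB [_ pd] zx; rewrite (hermitian_form_sym symB (sym_vectorE z)).
exact: pd (sym_vector_neq0 zx).
Qed.

End QuadraticForms.

Lemma hermitian_pd_psd (R : realType) m (M : 'M[R[i]]_m) :
  hermitian_pd M -> hermitian_psd M.
Proof.
move=> [hM pd]; split=> // x; have [->|/pd/ltW//] := eqVneq x 0.
by rewrite mulmx0 mxE.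
Qed.

Lemma dft_t_form (R : realType) (k n p : nat)
    (A : hypermatrix 'rV[R[i]]_p.+1 (k + k) n) (Z : 'M[R[i]]_(n, p.+1)) l :
  dft (t_form A Z) 0 l =
  hermitian_form (dft_slice A l) (fun x => dft (row x Z) 0 l).
Proof.
rewrite dft_sum; apply: eq_bigr => i _; rewrite dft_sum; apply: eq_bigr => j _.
rewrite dft_foldl big_cat !big_map /=; congr (_ * (_ * _)).
by rewrite rmorph_prod; apply: eq_bigr => x _; rewrite dft_conj.
Qed.

Theorem corollary3p32 (R : realType) (k n p : nat)
    (A : hypermatrix 'rV[R[i]]_p.+1 (k + k) n)
    (hk : (2 <= k)%N) (hn : (1 <= n)%N)
    (hA : t_conj_partially_symmetric A) :
  ((forall l : 'I_p.+1,
      hermitian_psd (M_cb (dft_slice A l)) \/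
      hermitian_psd (M_sym (dft_slice A l))) ->
    t_hermitian_psd (t_form A))
  /\
  ((forall l : 'I_p.+1, hermitian_pd (M_sym (dft_slice A l))) ->
    t_hermitian_pd (t_form A)).
Proof.
split=> [psd Z _ l|pd Z Z0].
  rewrite dft_t_form; case: (psd l); first exact: hermitian_form_cb_ge0.
  exact: hermitian_form_sym_ge0.
split=> [l|].
  by rewrite dft_t_form; apply/(hermitian_form_sym_ge0 hn)/hermitian_pd_psd.
(* By contraposition: a nonzero Fourier coefficient of some row, at position [l], would make the
   [l]-th coefficient of [t_form A Z] positive, although that tube is zero. *)
apply: contra_neq Z0 => h0; apply/row_matrixP => x; rewrite row0.
apply: dft_inj => l; apply/eqP; apply: contraT => zx.
have := hermitian_form_sym_gt0 hn (z := fun x => dft (row x Z) 0 l)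
  (hA l) (pd l) zx.
by rewrite -dft_t_form h0 dft0 ltxx.
Qed.
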